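(* Let $n\ge 1$ and let $W$ be the Landau–Ginzburg potential on $\mathrm{Conf}_3^\times(\widetilde{\mathcal F\ell})^\vee$ associated to $\mathrm{Conf}_3^\times(\widetilde{\mathcal F\ell})\subset\mathrm{Conf}_3(\widetilde{\mathcal F\ell})$. Take $a,b,c\in\mathbb Z_{>0}$. The restriction of $W$ to the torus $T_{M;s_0}$ of the initial seed is $$W=\sum_{a+b=n}\vartheta_{(a,b,0)}+\sum_{b+c=n}\vartheta_{(0,b,c)}+\sum_{a+c=n}\vartheta_{(a,0,c)},$$ where $$\vartheta_{(a,b,0)}=\sum_{i=0}^{n-a-1}z^{-\sum_{j=0}^ie_{(a,b-j,j)}},\qquad \vartheta_{(0,b,c)}=\sum_{i=0}^{n-b-1}z^{-\sum_{j=0}^ie_{(j,b,c-j)}},\qquad \vartheta_{(a,0,c)}=\sum_{i=0}^{n-c-1}z^{-\sum_{j=0}^ie_{(a-j,j,c)}}.$$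
   Context: **Cluster data.** $\mathcal H=\{(a,b,c)\in\mathbb Z_{\ge0}^3:a+b+c=n\}$; an index is unfrozen if $a,b,c>0$, else frozen. The quiver $Q$ has vertex set $\mathcal H$ and an arrow from $(a,b,c)$ to each of $(a-1,b+1,c),(a,b-1,c+1),(a+1,b,c-1)$ in $\mathcal H$, arrows between two frozen vertices omitted. On $\mathbb Z^{\mathcal H}$ with basis $e_i$ put $\{e_i,e_j\}=\#(i\to j)-\#(j\to i)$; $N=\mathbb Z^{\mathcal H}/\mathbb Z\mathbf 1$ ($\mathbf 1$ all-ones); $\{\mathbf 1,e_k\}=0$ for $k$ unfrozen, so $\{n',e_k\}$ makes sense for $n'\in N$. Initial seed $s_0=(e_i)$; mutation at unfrozen $k$: $e_k'=-e_k$, $e_i'=e_i+[\{e_i,e_k\}]_+e_k$ for $i\ne k$, $[x]_+=\max\{0,x\}$. This is the initial data of the cluster $\mathcal A$-variety $\mathrm{Conf}_3^\times(\widetilde{\mathcal F\ell})$ of triples of decorated flags (complete flags in $\mathbb C^n$ with a nonzero vector in each successive quotient) modulo $\mathrm{GL}_n$ with pairwise generic underlying flags; $\mathrm{Conf}_3(\widetilde{\mathcal F\ell})$ is the space of all triples modulo $\mathrm{GL}_n$. The Fock–Goncharov dual $\mathrm{Conf}_3^\times(\widetilde{\mathcal F\ell})^\vee$ is glued from tori $T_{M;s}=\mathrm{Spec}\,\mathbb C[N]$, one for each seed $s$, via the birational maps $\mu_k:T_{M;s}\dashrightarrow T_{M;\mu_k(s)}$, $\mu_k^*(z^{n'})=z^{n'}(1+z^{e_k})^{-\{n',e_k\}}$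 ($e_k$ in $s$). **Potential.** The irreducible components of $\mathrm{Conf}_3(\widetilde{\mathcal F\ell})\setminus\mathrm{Conf}_3^\times(\widetilde{\mathcal F\ell})$ are the divisors $D_f=\{A_f=0\}$ for frozen $f$ with exactly one entry zero, where $A_{(a,b,c)}(X,Y,Z)=\omega(x_1\wedge\dots\wedge x_a\wedge y_1\wedge\dots\wedge y_b\wedge z_1\wedge\dots\wedge z_c)$. A seed $s$ is optimized for $f$ if $\{e_k,e_f\}\ge0$ for all unfrozen $k$ (basis vectors of $s$). The theta function $\vartheta_f$ attached to $D_f$ is the function on $\mathrm{Conf}_3^\times(\widetilde{\mathcal F\ell})^\vee$ equal to $z^{-e_{f;s}}$ on $T_{M;s}$ for $s$ optimized for $f$ (such seeds exist for each $f$), and $W=\sum_f\vartheta_f$. *)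

(* Defs.v *)
From HB Require Import structures.
From mathcomp Require Import all_boot all_order all_algebra.
From mathcomp Require Import generic_quotient ring_quotient fraction.
From mathcomp Require Import finmap.
From mathcomp Require Import boolp reals.
From mathcomp Require Import complex zify.
From mathcomp Require Import monalg.

Set Implicit Arguments.
Unset Strict Implicit.
Unset Printing Implicit Defensive.

Import Order.TTheory GRing.Theory Num.Theory.
Local Open Scope ring_scope.
Local Open Scope quotient_scope.
Local Open Scope complex_scope.

(* The group algebra A[G] of an additive group G: the ring structure that
   multinomials puts on {malg A[G]} needs a monoid without nontrivial units,
   so the convolution product is redefined here. *)
Definition grpalg (A : comNzRingType) (G : zmodType) := {malg A[G]}.

HB.instance Definition _ (A : comNzRingType) (G : zmodType) :=
  GRing.Zmodule.on (grpalg A G).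

Section GroupAlgebra.
Variables (A : comNzRingType) (G : zmodType).
Implicit Types (p q r : grpalg A G) (x y : G) (c : A).

Definition grpalg_one : grpalg A G := << (0 : G) >>.

Definition grpalg_mul p q : grpalg A G :=
  \sum_(x <- msupp p) \sum_(y <- msupp q) << p@_x * q@_y *g x + y >>.

Lemma grpalg_mulw (d1 d2 : {fset G}) p q :
  (msupp p `<=` d1)%fset -> (msupp q `<=` d2)%fset ->
  grpalg_mul p q = \sum_(x <- d1) \sum_(y <- d2) << p@_x * q@_y *g x + y >>.
Proof.
move=> le_d1 le_d2; rewrite /grpalg_mul (big_fset_incl _ le_d1) /=.
  apply/eq_bigr=> k1 _; apply/big_fset_incl => // k _ /mcoeff_outdom ->.
  by rewrite mulr0 monalgU0.
move=> k _ /mcoeff_outdom g1k.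
by rewrite big1 => // k' _; rewrite g1k mul0r monalgU0.
Qed.

Lemma grpalg_mulC : commutative grpalg_mul.
Proof.
move=> p q; rewrite /grpalg_mul exchange_big; apply: eq_bigr => y _.
by apply: eq_bigr => x _; rewrite mulrC addrC.
Qed.

Lemma grpalg_mul0 : left_zero 0 grpalg_mul.
Proof. by move=> p; rewrite /grpalg_mul msupp0 big_seq_fset0. Qed.

Lemma grpalg_mulDl : left_distributive grpalg_mul +%R.
Proof.
move=> p q r.
rewrite (@grpalg_mulw _ (msupp r) _ _ (msuppD_le p q)) ?fsubset_refl //.
rewrite (grpalg_mulw (fsubsetUl (msupp p) (msupp q)) (fsubset_refl (msupp r))).
rewrite (grpalg_mulw (fsubsetUr (msupp p) (msupp q)) (fsubset_refl (msupp r))).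
rewrite -big_split /=; apply/eq_bigr=> k1 _.
rewrite -big_split /=; apply/eq_bigr=> k2 _.
by rewrite mcoeffD mulrDl monalgUD.
Qed.

Lemma grpalg_mulUU c1 c2 x y :
  grpalg_mul << c1 *g x >> << c2 *g y >> = << c1 * c2 *g x + y >>.
Proof. by rewrite (grpalg_mulw msuppU_le msuppU_le) !big_seq_fset1 !mcoeffUU. Qed.

Lemma grpalg_mul_suml I (s : seq I) (F : I -> grpalg A G) q :
  grpalg_mul (\sum_(i <- s) F i) q = \sum_(i <- s) grpalg_mul (F i) q.
Proof.
exact: (big_morph (grpalg_mul^~ q) (fun _ _ => grpalg_mulDl _ _ _)
          (grpalg_mul0 q)).
Qed.

Lemma grpalg_mul_sumr I (s : seq I) (F : I -> grpalg A G) q :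
  grpalg_mul q (\sum_(i <- s) F i) = \sum_(i <- s) grpalg_mul q (F i).
Proof.
rewrite grpalg_mulC grpalg_mul_suml.
by apply: eq_bigr => i _; rewrite grpalg_mulC.
Qed.

Lemma grpalg_mulA : associative grpalg_mul.
Proof.
move=> p q r; rewrite [p]monalgE [q]monalgE [r]monalgE.
move: (msupp p) (msupp q) (msupp r) (mcoeff^~ p) (mcoeff^~ q) (mcoeff^~ r).
move=> sp sq sr cp cq cr.
rewrite [LHS]grpalg_mul_suml.
rewrite [X in _ = grpalg_mul X _]grpalg_mul_suml [RHS]grpalg_mul_suml.
apply: eq_bigr => x _.
rewrite [X in grpalg_mul _ X]grpalg_mul_suml [LHS]grpalg_mul_sumr.
rewrite [X in _ = grpalg_mul X _]grpalg_mul_sumr [RHS]grpalg_mul_suml.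
apply: eq_bigr => y _.
rewrite [X in grpalg_mul _ X]grpalg_mul_sumr [LHS]grpalg_mul_sumr.
rewrite [RHS]grpalg_mul_sumr; apply: eq_bigr => z _.
by rewrite !grpalg_mulUU mulrA addrA.
Qed.

Lemma grpalg_mul1 : left_id grpalg_one grpalg_mul.
Proof.
move=> p; rewrite {1}[p]monalgE grpalg_mul_sumr [RHS]monalgE.
apply: eq_bigr => x _; by rewrite grpalg_mulUU mul1r add0r.
Qed.

Lemma grpalg_one_neq0 : grpalg_one != 0.
Proof. by rewrite monalgU_eq0 oner_eq0. Qed.

HB.instance Definition _ := GRing.Zmodule_isComNzRing.Build (grpalg A G)
  grpalg_mulA grpalg_mulC grpalg_mul1 grpalg_mulDl grpalg_one_neq0.

Lemma grpalg_mulUUE c1 c2 x y :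
  (<< c1 *g x >> : grpalg A G) * (<< c2 *g y >> : grpalg A G) =
  << c1 * c2 *g x + y >>.
Proof. exact: grpalg_mulUU. Qed.

Lemma mcoeff_grpalgM p q z :
  (p * q)@_z =
  \sum_(x <- msupp p) \sum_(y <- msupp q) p@_x * q@_y *+ (x + y == z).
Proof.
rewrite [p * q]/(grpalg_mul p q) /grpalg_mul raddf_sum /=.
apply: eq_bigr => x _; rewrite raddf_sum /=.
by apply: eq_bigr => y _; rewrite mcoeffU.
Qed.

End GroupAlgebra.

(* A group embedded in {poly int}, ordered by the sign of the leading
   coefficient, has a group algebra without zero divisors. *)
Section GroupAlgebraDomain.
Variables (A : idomainType) (G : zmodType) (phi : {additive G -> {poly int}}).
Hypothesis phi_inj : injective phi.

Let pos (p : {poly int}) := 0 < lead_coef p.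

Let posD p q : pos p -> pos q -> pos (p + q).
Proof.
rewrite /pos => p0 q0; case: (ltngtP (size p) (size q)) => h.
- by rewrite lead_coefDr.
- by rewrite lead_coefDl.
have cE : (p + q)`_(size p).-1 = lead_coef p + lead_coef q.
  by rewrite coefD !lead_coefE h.
have c0 : 0 < (p + q)`_(size p).-1 by rewrite cE addr_gt0.
have sE : size (p + q) = size p.
  apply/eqP; rewrite eqn_leq; apply/andP; split.
    by rewrite (leq_trans (size_polyD _ _)) // h maxnn.
  have p1 : (0 < size p)%N.
    by rewrite lt0n size_poly_eq0; apply: contraTneq p0 => ->; rewrite lead_coef0.
  rewrite -(prednK p1) ltnNge; apply/negP => /leq_sizeP /(_ _ (leqnn _)) e.
  by rewrite e ltxx in c0.
by rewrite lead_coefE sE.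
Qed.

Let lt x y := pos (phi y - phi x).

Let lt_irr x : lt x x = false.
Proof. by rewrite /lt /pos subrr lead_coef0 ltxx. Qed.

Let lt_total x y : [|| x == y, lt x y | lt y x].
Proof.
case: eqVneq => //= ne; rewrite /lt /pos.
rewrite -[phi x - phi y]opprB lead_coefN oppr_gt0.
have : lead_coef (phi y - phi x) != 0.
  by rewrite lead_coef_eq0 subr_eq0; apply: contra_neq ne => /phi_inj ->.
by rewrite neq_lt orbC.
Qed.

Let lt_trans y x z : lt x y -> lt y z -> lt x z.
Proof.
move=> xy yz; rewrite /lt -[phi z](subrK (phi y)) -addrA.
exact: posD.
Qed.

Let ltD x x' y y' : lt x x' -> lt y y' -> lt (x + y) (x' + y').
Proof. by move=> xx yy; rewrite /lt !(raddfD phi) opprD addrACA; apply: posD. Qed.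

Let ltDr x y y' : lt y y' -> lt (x + y) (x + y').
Proof. by rewrite /lt !(raddfD phi) opprD addrACA subrr add0r. Qed.

Let ltDl x x' y : lt x x' -> lt (x + y) (x' + y).
Proof. by rewrite /lt !(raddfD phi) opprD addrACA subrr addr0. Qed.

Let has_max (s : seq G) : s != [::] ->
  exists2 m, m \in s & forall x, x \in s -> x = m \/ lt x m.
Proof.
elim: s => // a [|b s] IH _.
  by exists a; rewrite ?mem_seq1 // => x; rewrite mem_seq1 => /eqP; left.
have [//|m ms mP] := IH; have := lt_total a m.
case/or3P => [/eqP am|am|ma].
- exists m; rewrite ?in_cons -?am ?eqxx // => x.
  by rewrite in_cons => /predU1P[->|/mP]; [left|rewrite am].
- exists m; first by rewrite in_cons ms orbT.
  by move=> x; rewrite in_cons => /predU1P[->|/mP //]; right.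
- exists a; first by rewrite mem_head.
  move=> x; rewrite in_cons => /predU1P[->|/mP [->|xm]]; [by left|by right|].
  by right; apply: lt_trans ma.
Qed.

Lemma grpalg_integral (p q : grpalg A G) : p * q = 0 -> (p == 0) || (q == 0).
Proof.
move=> pq0; apply/norP => -[p0 q0].
have supp0 (g : grpalg A G) : g != 0 -> (msupp g : seq G) != [::].
  apply: contra_neq => g0; apply/malgP => x; rewrite mcoeff0 mcoeff_outdom //.
  by apply/negP => xg; have : x \in (msupp g : seq G) by []; rewrite g0.
have [m mp mP] := has_max (supp0 p p0).
have [l lq lP] := has_max (supp0 q q0).
have : (p * q)@_(m + l) = p@_m * q@_l.
  rewrite mcoeff_grpalgM (big_fsetD1 m) //= (big_fsetD1 l) //= eqxx mulr1n.
  rewrite [X in _ + X + _]big_seq [X in _ + X + _]big1 => [|y]; last first.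
    rewrite in_fsetD1 => /andP[yl yq].
    have [/eqP|ly] := lP _ yq; first by rewrite (negPf yl).
    by case: eqP => // e; have := ltDr m ly; rewrite e lt_irr.
  rewrite [X in _ + X]big_seq [X in _ + X]big1 ?addr0 // => x.
  rewrite in_fsetD1 => /andP[xm xp].
  have [/eqP|lx] := mP _ xp; first by rewrite (negPf xm).
  rewrite big_seq big1 // => y yq; case: eqP => // e.
  have := lt_irr (m + l); rewrite -[X in lt X _]e.
  have [->|ly] := lP _ yq; first by rewrite ltDl.
  by rewrite ltD.
rewrite pq0 mcoeff0 => /esym/eqP; rewrite mulf_eq0.
by rewrite !mcoeff_eq0 mp lq.
Qed.

End GroupAlgebraDomain.

Definition hive (n : nat) :=
  {h : 'I_n.+1 * 'I_n.+1 * 'I_n.+1 | (h.1.1 + h.1.2 + h.2 == n)%N}.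

HB.instance Definition _ (n : nat) := Finite.on (hive n).

Definition coords n (h : hive n) : nat * nat * nat :=
  ((val h).1.1 : nat, (val h).1.2 : nat, (val h).2 : nat).

Definition unfrozen n (h : hive n) : bool :=
  let: (a, b, c) := coords h in [&& 0 < a, 0 < b & 0 < c]%N.

Definition uf_index (n : nat) := {h : hive n | unfrozen h}.

HB.instance Definition _ (n : nat) := Finite.on (uf_index n).

Definition arrow n (i j : hive n) : bool :=
  let: (a, b, c) := coords i in
  let: (a', b', c') := coords j in
  (unfrozen i || unfrozen j) &&
  [|| [&& a == a'.+1, b' == b.+1 & c' == c],
      [&& a' == a, b == b'.+1 & c' == c.+1]
    | [&& a' == a.+1, b' == b & c == c'.+1]]%N.

Definition lattice (n : nat) := {ffun hive n -> int}.

HB.instance Definition _ (n : nat) := GRing.Zmodule.on (lattice n).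

(* The basis vector e_(a,b,c); it is the zero vector when (a,b,c) is not in hive n *)
Definition evec n (a b c : nat) : lattice n :=
  [ffun h => (coords h == (a, b, c))%:R].

Definition form n (x y : lattice n) : int :=
  \sum_i \sum_j x i * y j * ((arrow i j)%:R - (arrow j i)%:R).

(* The multiples of the all-ones vector are the constant functions. *)
Definition ones_line n : {pred lattice n} :=
  [pred x : lattice n | [forall i, forall j, x i == x j]].

Arguments ones_line : clear implicits.

Fact corner_subproof n :
  ((ord_max : 'I_n.+1) + (ord0 : 'I_n.+1) + (ord0 : 'I_n.+1) == n)%N.
Proof. by rewrite /= !addn0. Qed.

Definition corner n : hive n := exist _ (ord_max, ord0, ord0) (corner_subproof n).

Lemma ones_lineP n (x : lattice n) :
  reflect (exists m : int, x = [ffun=> 1] *~ m) (x \in ones_line n).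
Proof.
apply: (iffP forallP) => [xP|[m ->] i].
  exists (x (corner n)); apply/ffunP => i; rewrite ffunMzE ffunE.
  by rewrite (eqP (forallP (xP i) (corner n))) intz.
by apply/forallP => j; rewrite !ffunMzE !ffunE.
Qed.

Fact ones_line_zmod_closed n : zmod_closed (ones_line n).
Proof.
split=> [|x y /ones_lineP[m ->] /ones_lineP[l ->]].
  by apply/ones_lineP; exists 0; rewrite mulr0z.
by apply/ones_lineP; exists (m - l); rewrite mulrzBr.
Qed.

HB.instance Definition _ n :=
  GRing.isZmodClosed.Build (lattice n) (ones_line n) (ones_line_zmod_closed n).

(* N = Z^H / Z 1 *)
Definition charlat (n : nat) := Quotient.quot (ones_line n).

HB.instance Definition _ n := GRing.Zmodule.on (charlat n).
HB.instance Definition _ n := EqQuotient.on (charlat n).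

Definition to_charlat n (x : lattice n) : charlat n := \pi_(charlat n) x.

Lemma to_charlat_is_zmod_morphism n : zmod_morphism (@to_charlat n).
Proof. by move=> x y; rewrite /to_charlat raddfB. Qed.

HB.instance Definition _ n :=
  GRing.isZmodMorphism.Build (lattice n) (charlat n) (@to_charlat n)
    (@to_charlat_is_zmod_morphism n).

Lemma to_charlat_eq n (x y : lattice n) :
  (to_charlat x == to_charlat y) = (x - y \in ones_line n).
Proof. by rewrite Quotient.idealrBE. Qed.

Lemma to_charlatK n (u : charlat n) : to_charlat (repr u) = u.
Proof. exact: reprK. Qed.

Section CharlatOrder.
Variable n : nat.

Definition charlat_poly (u : charlat n) : {poly int} :=
  \sum_(h : hive n) (repr u h - repr u (corner n)) *: 'X^(enum_rank h).

Lemma coef_charlat_poly u (h : hive n) :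
  (charlat_poly u)`_(enum_rank h) = repr u h - repr u (corner n).
Proof.
rewrite coef_sum (bigD1 h) //= coefZ coefXn eqxx mulr1 big1 ?addr0 // => g gh.
rewrite coefZ coefXn; case: eqP => [/ord_inj/enum_rank_inj hg|]; rewrite ?mulr0 //.
by rewrite hg eqxx in gh.
Qed.

Let sub_eq (a b x y x' y' : int) :
  a - (x - y) = b - (x' - y') -> a - b = x - x' - (y - y').
Proof. by lia. Qed.

Let sub_eq2 (a b x y k l : int) :
  a - k = b - l -> x - k = y - l -> a - b = x - y.
Proof. by lia. Qed.

Lemma charlat_poly_is_zmod_morphism : zmod_morphism charlat_poly.
Proof.
move=> u v; rewrite /charlat_poly -sumrB; apply: eq_bigr => h _.
rewrite -scalerBl; congr (_ *: _).
have : to_charlat (repr (u - v)) == to_charlat (repr u - repr v).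
  by rewrite raddfB /= !to_charlatK.
rewrite to_charlat_eq => /forallP /(_ h) /forallP /(_ (corner n)) /eqP.
by rewrite !ffunE; exact: sub_eq.
Qed.

HB.instance Definition _ := GRing.isZmodMorphism.Build (charlat n) {poly int}
  charlat_poly charlat_poly_is_zmod_morphism.

Lemma charlat_poly_inj : injective charlat_poly.
Proof.
move=> u v uv; rewrite -[u]to_charlatK -[v]to_charlatK; apply/eqP.
rewrite to_charlat_eq.
have E h : repr u h - repr u (corner n) = repr v h - repr v (corner n).
  by rewrite -!coef_charlat_poly uv.
apply/forallP => i; apply/forallP => j; rewrite !ffunE; apply/eqP.
exact: sub_eq2 (E i) (E j).
Qed.

End CharlatOrder.

(* The coordinate ring C[N] of each torus T_{M;s}. *)
Definition torus_ring (R : realType) (n : nat) := grpalg R[i] (charlat n).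

HB.instance Definition _ R n := GRing.ComNzRing.on (torus_ring R n).

Section TorusRingDomain.
Variables (R : realType) (n : nat).
Implicit Types p q : torus_ring R n.

Definition torus_unit : {pred torus_ring R n} :=
  fun p => `[< exists q, q * p = 1 >].

Definition torus_inv p : torus_ring R n :=
  if pselect (exists q, q * p = 1) is left pP then projT1 (cid pP) else p.

Lemma torus_mulVr : {in torus_unit, left_inverse 1 torus_inv *%R}.
Proof.
move=> p /asboolP pP; rewrite /torus_inv; case: pselect => // pP'.
by case: cid.
Qed.

Lemma torus_unitPl p q : q * p = 1 -> p \in torus_unit.
Proof. by move=> qp; apply/asboolP; exists q. Qed.

Lemma torus_inv_out : {in [predC torus_unit], torus_inv =1 id}.
Proof.
move=> p /negP pP; rewrite /torus_inv; case: pselect => // pP'.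
by case: pP; apply/asboolP.
Qed.

HB.instance Definition _ := GRing.ComNzRing_hasMulInverse.Build (torus_ring R n)
  torus_mulVr torus_unitPl torus_inv_out.

Lemma torus_ring_integral : GRing.integral_domain_axiom (torus_ring R n).
Proof. by move=> p q; apply: grpalg_integral; apply: charlat_poly_inj. Qed.

HB.instance Definition _ := GRing.ComUnitRing_isIntegral.Build (torus_ring R n)
  torus_ring_integral.

End TorusRingDomain.

(* The monomial z^x for x in Z^H, with x read in N. *)
Definition zexp (R : realType) n (x : lattice n) : torus_ring R n :=
  << to_charlat x >>.

Definition seed n := hive n -> lattice n.

Definition initial_seed n : seed n :=
  fun h => let: (a, b, c) := coords h in evec n a b c.

Definition mutate n (s : seed n) (k : uf_index n) : seed n := fun i =>
  if i == val k then - s (val k)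
  else s i + s (val k) *~ Num.max 0 (form (s i) (s (val k))).

(* Mutation is not an involution on labelled bases, so seeds are indexed by
   the vertices of the rooted tree of mutations: the word [:: k1; ...; km]
   stands for mu_km (... (mu_k1 s_0)). *)
Definition seed_at n (w : seq (uf_index n)) : seed n :=
  foldl (@mutate n) (@initial_seed n) w.

Notation "x %:F" := (@FracField.tofrac _ x) : ring_scope.

(* {u, e_k} for u in N and e_k in a seed; the choice of representative of u
   is immaterial by charlat_form_pi below. *)
Definition charlat_form n (u : charlat n) (x : lattice n) : int :=
  form (repr u) x.

Section FormBalance.
Variable n : nat.
Implicit Types (x y : lattice n) (h i : hive n).

Lemma formBl x x' y : form (x - x') y = form x y - form x' y.
Proof.
rewrite /form -sumrB; apply: eq_bigr => i _; rewrite -sumrB.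
by apply: eq_bigr => j _; rewrite !ffunE !mulrBl.
Qed.

Lemma formBr x y y' : form x (y - y') = form x y - form x y'.
Proof.
rewrite /form -sumrB; apply: eq_bigr => i _; rewrite -sumrB.
by apply: eq_bigr => j _; rewrite !ffunE -mulrBl -mulrBr.
Qed.

HB.instance Definition _ x :=
  GRing.isZmodMorphism.Build (lattice n) int (form x) (formBr x).

Lemma coords_inj : injective (@coords n).
Proof.
case=> [[[a b] c] /= h] [[[a' b'] c'] /= h'] [] /= aE bE cE.
by apply: val_inj => /=; congr (_, _, _); apply: val_inj.
Qed.

Let sum_coords (a b c : nat) : (a + b + c = n)%N ->
  \sum_(i : hive n) (coords i == (a, b, c))%:R = 1 :> int.
Proof.
move=> abc; have [an bn cn] : [/\ a < n.+1, b < n.+1 & c < n.+1]%N by split; lia.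
have hP : ((Ordinal an : nat) + (Ordinal bn : nat) + (Ordinal cn : nat) == n)%N.
  by rewrite /= abc.
pose h : hive n := exist _ (Ordinal an, Ordinal bn, Ordinal cn) hP.
rewrite (bigD1 h) //= eqxx big1 ?addr0 // => i ih.
by case: eqP => // iE; case/eqP: ih; apply: coords_inj; rewrite iE.
Qed.

Let sum3 (P : hive n -> bool) (a b c a' b' c' a'' b'' c'' : nat) :
    (a + b + c = n)%N -> (a' + b' + c' = n)%N -> (a'' + b'' + c'' = n)%N ->
    (forall i, (P i)%:R = (coords i == (a, b, c))%:R
       + (coords i == (a', b', c'))%:R + (coords i == (a'', b'', c''))%:R :> int) ->
  \sum_i (P i)%:R = 3 :> int.
Proof.
move=> h1 h2 h3 PE; rewrite (eq_bigr _ (fun i _ => PE i)) !big_split /=.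
by rewrite !sum_coords.
Qed.

Let or3_natr (P Q S : bool) : ~ (P /\ Q) -> ~ (P /\ S) -> ~ (Q /\ S) ->
  [|| P, Q | S]%:R = P%:R + Q%:R + S%:R :> int.
Proof. by case: P Q S => [] [] [] // h1 h2 h3; exfalso; auto. Qed.

Lemma arrow_balance h : unfrozen h ->
  \sum_i ((arrow i h)%:R - (arrow h i)%:R) = 0 :> int.
Proof.
move=> uh; rewrite sumrB; apply/eqP; rewrite subr_eq0; apply/eqP.
have := uh; rewrite /unfrozen; case hE: (coords h) => [[a b] c] /and3P[a0 b0 c0].
have hn : (a + b + c = n)%N.
  by case: h hE {uh} => [[[a1 b1] c1] /= hP] [<- <- <-]; apply/eqP.
transitivity (3 : int); [|symmetry].
- apply: (@sum3 _ a.+1 b.-1 c a b.+1 c.-1 a.-1 b c.+1); rewrite /=; try lia.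
  move=> i; rewrite /arrow uh orbT hE; case: (coords i) => [[x y] z] /=.
  rewrite -(prednK a0) -(prednK b0) -(prednK c0) /= !eqSS.
  move: a.-1 b.-1 c.-1 => {a b c a0 b0 c0 hE hn} a b c.
  rewrite or3_natr.
  + rewrite !xpair_eqE -!andbA; congr (_%:R + _%:R + _%:R);
      by congr [&& _, _ & _]; rewrite // eq_sym.
  + by case=> /and3P[/eqP ? /eqP ? /eqP ?] /and3P[/eqP ? /eqP ? /eqP ?]; lia.
  + by case=> /and3P[/eqP ? /eqP ? /eqP ?] /and3P[/eqP ? /eqP ? /eqP ?]; lia.
  + by case=> /and3P[/eqP ? /eqP ? /eqP ?] /and3P[/eqP ? /eqP ? /eqP ?]; lia.
- apply: (@sum3 _ a.-1 b.+1 c a b.-1 c.+1 a.+1 b c.-1); rewrite /=; try lia.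
  move=> i; rewrite /arrow uh hE; case: (coords i) => [[x y] z] /=.
  rewrite -(prednK a0) -(prednK b0) -(prednK c0) /= !eqSS.
  move: a.-1 b.-1 c.-1 => {a b c a0 b0 c0 hE hn} a b c.
  rewrite or3_natr.
  + rewrite !xpair_eqE -!andbA; congr (_%:R + _%:R + _%:R);
      by congr [&& _, _ & _]; rewrite // eq_sym.
  + by case=> /and3P[/eqP ? /eqP ? /eqP ?] /and3P[/eqP ? /eqP ? /eqP ?]; lia.
  + by case=> /and3P[/eqP ? /eqP ? /eqP ?] /and3P[/eqP ? /eqP ? /eqP ?]; lia.
  + by case=> /and3P[/eqP ? /eqP ? /eqP ?] /and3P[/eqP ? /eqP ? /eqP ?]; lia.
Qed.

Lemma initial_seedE h h' : initial_seed h h' = (h' == h)%:R.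
Proof.
rewrite /initial_seed; case hE: (coords h) => [[a b] c].
by rewrite ffunE -hE (inj_eq coords_inj).
Qed.

Lemma form_ones_seed (w : seq (uf_index n)) (k : uf_index n) x :
  x \in ones_line n -> form x (seed_at w (val k)) = 0.
Proof.
move=> x1; rewrite /seed_at.
have : forall k : uf_index n, form x (initial_seed (val k)) = 0.
  move=> l; have [m ->] := ones_lineP x x1.
  rewrite /form exchange_big (bigD1 (val l)) //= [X in _ + X]big1 => [|j jl].
    rewrite addr0 initial_seedE eqxx.
    under eq_bigr do rewrite ffunMzE ffunE mulr1.
    by rewrite -mulr_sumr arrow_balance ?mulr0 //; case: (l).
  rewrite initial_seedE (negPf jl) big1 // => i _.
  by rewrite mulr0 mul0r.
elim: w (@initial_seed n) k => [|l w IH] s k s0 /=; first exact: s0.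
apply: IH => {k} k; rewrite /mutate; case: eqP => _.
  by rewrite raddfN /= s0 oppr0.
by rewrite raddfD /= raddfMz /= !s0 mul0rz addr0.
Qed.

Lemma charlat_form_pi (w : seq (uf_index n)) (k : uf_index n) x :
  charlat_form (to_charlat x) (seed_at w (val k)) = form x (seed_at w (val k)).
Proof.
apply/eqP; rewrite /charlat_form -subr_eq0 -formBl; apply/eqP.
by apply: form_ones_seed; rewrite -to_charlat_eq to_charlatK.
Qed.

End FormBalance.

(* mu_k^* on C[N], with values in its fraction field:
   z^u |-> z^u (1 + z^(e_k))^(-{u, e_k}), where ek is e_k. *)
Definition mutation_pullback (R : realType) n (ek : lattice n)
    (g : torus_ring R n) : {fraction torus_ring R n} :=
  mmap (fun c : R[i] => (<< c *g 0 >> : torus_ring R n)%:F)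
       (fun u : charlat n => (<< u >> : torus_ring R n)%:F *
                             (1 + zexp R ek)%:F ^ (- charlat_form u ek)) g.

Lemma mutation_pullback_zexp (R : realType) n (w : seq (uf_index n))
    (k : uf_index n) (x : lattice n) :
  mutation_pullback (seed_at w (val k)) (zexp R x) =
  (zexp R x)%:F * (1 + zexp R (seed_at w (val k)))%:F
    ^ (- form x (seed_at w (val k))).
Proof.
rewrite /mutation_pullback /mmap msuppU oner_eq0 big_seq_fset1 mcoeffUU.
by rewrite charlat_form_pi (rmorph1 (@FracField.tofrac _)) mul1r.
Qed.

(* A regular function on the dual is a family of regular functions on the tori
   T_{M;s} matched by the gluing maps mu_k : T_{M;s} --> T_{M;mu_k(s)}. *)
Definition dual_function (R : realType) n
    (g : seq (uf_index n) -> torus_ring R n) : Prop :=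
  forall w k, (g w)%:F = mutation_pullback (seed_at w (val k)) (g (rcons w k)).

Definition optimized n (w : seq (uf_index n)) (f : hive n) : Prop :=
  forall k : uf_index n, 0 <= form (seed_at w (val k)) (seed_at w f).

Definition is_theta (R : realType) n (f : hive n)
    (g : seq (uf_index n) -> torus_ring R n) : Prop :=
  dual_function g /\
  forall w, optimized w f -> g w = zexp R (- seed_at w f).

(* Indices of the divisors D_f: exactly one entry is zero. *)
Definition boundary n (f : hive n) : bool :=
  let: (a, b, c) := coords f in ((a == 0) + (b == 0) + (c == 0) == 1)%N.

Definition LG_potential (R : realType) n
    (theta : hive n -> seq (uf_index n) -> torus_ring R n) :
    seq (uf_index n) -> torus_ring R n :=
  fun w => \sum_(f | boundary f) theta f w.

(* Main.v *)
(* A boundary vertex f is the start of a straight line f = p_0 -> ... -> p_m of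
   the quiver whose other vertices are unfrozen.  Put E_j = e_(p_0) + ... +
   e_(p_j).  The mutations at p_1, ..., p_m, in this order, turn e_f into
   E_1, ..., E_m, and the seed reached at the end is optimized for f, because
   {e_l, E_j} >= 0 is preserved for every unfrozen l off the line and every
   j not yet passed.  Hence the theta function is z^(-E_m) there.  In the
   pullback along the mutation at p_i, the monomials z^(-E_j) with j > i are
   unchanged and z^(-E_i) becomes z^(-E_i) + z^(-E_(i-1)), so that the initial
   torus carries the sum of all z^(-E_j).  The three families of lines are
   exchanged by the cyclic symmetry of the quiver. *)
Require Import Defs.
From HB Require Import structures.
From mathcomp Require Import all_boot all_order all_algebra.
From mathcomp Require Import reals complex zify monalg fraction.

Set Implicit Arguments.
Unset Strict Implicit.
Unset Printing Implicit Defensive.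

Import Order.TTheory GRing.Theory Num.Theory.
Local Open Scope ring_scope.

Local Notation form := Defs.form.

(** * Bilinearity of the form and additivity of the pullback *)

Lemma form_antisym n (x y : lattice n) : form x y = - form y x.
Proof.
rewrite /form exchange_big -sumrN; apply: eq_bigr => i _.
rewrite -sumrN; apply: eq_bigr => j _.
by rewrite [x j * y i]mulrC -mulrN opprB.
Qed.

Lemma formDl n (x x' y : lattice n) : form (x + x') y = form x y + form x' y.
Proof. by rewrite 3!(form_antisym _ y) raddfD opprD. Qed.

Lemma formNl n (x y : lattice n) : form (- x) y = - form x y.
Proof. by rewrite 2!(form_antisym _ y) raddfN. Qed.

Lemma formMzl n (x y : lattice n) (z : int) : form (x *~ z) y = form x y *~ z.
Proof. by rewrite 2!(form_antisym _ y) raddfMz mulNrz. Qed.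

Lemma form_initial_seed n (g h : hive n) :
  form (initial_seed g) (initial_seed h) = (arrow g h)%:R - (arrow h g)%:R.
Proof.
rewrite /form (bigD1 g) //= (bigD1 h) //= !initial_seedE !eqxx !mul1r.
rewrite [X in _ + X + _]big1 => [|j jh]; last first.
  by rewrite initial_seedE (negPf jh) mulr0 mul0r.
rewrite [X in _ + X]big1 ?addr0 // => i ig.
by rewrite big1 // => j _; rewrite initial_seedE (negPf ig) !mul0r.
Qed.

Lemma seed_at_rcons n (w : seq (uf_index n)) k :
  seed_at (rcons w k) = mutate (seed_at w) k.
Proof. by rewrite /seed_at foldl_rcons. Qed.

Lemma zexpM (R : realType) n (x y : lattice n) :
  zexp R x * zexp R y = zexp R (x + y).
Proof. by rewrite [LHS]grpalg_mulUUE mulr1 /zexp raddfD. Qed.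

(** The coefficient map inside [mutation_pullback], named so that it can carry the additive
    structure that [mmapB] asks for. *)
Definition const_frac (R : realType) n (c : R[i]) :
  {fraction torus_ring R n} := (<< c *g 0 >> : torus_ring R n)%:F.

Lemma const_frac_is_zmod_morphism (R : realType) n :
  zmod_morphism (@const_frac R n).
Proof.
by move=> x y; rewrite /const_frac monalgUB (tofracB (R := torus_ring R n)).
Qed.

HB.instance Definition _ (R : realType) n :=
  GRing.isZmodMorphism.Build R[i] {fraction torus_ring R n}
    (@const_frac R n) (@const_frac_is_zmod_morphism R n).

Lemma mutation_pullback_is_zmod_morphism (R : realType) n (x : lattice n) :
  zmod_morphism (@mutation_pullback R n x).
Proof. by move=> p q; exact: (mmapB (f := @const_frac R n)). Qed.

HB.instance Definition _ (R : realType) n (x : lattice n) :=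
  GRing.isZmodMorphism.Build (torus_ring R n) {fraction torus_ring R n}
    (@mutation_pullback R n x) (@mutation_pullback_is_zmod_morphism R n x).

(** * Mutations along a straight path *)

Definition off_path n (p : nat -> hive n) m (l : hive n) :=
  unfrozen l /\ forall t, (t <= m)%N -> l != p t.

(* [p 0 -> ... -> p m] is a straight line of the quiver starting at a frozen
   vertex: in the last clause, the vertex [l] next to the edge [p t -> p t.+1]
   completes it to an oriented triangle. *)
Definition straight_path n (p : nat -> hive n) m : Prop :=
  [/\ forall t, (t < m)%N -> unfrozen (p t.+1),
      forall s t, (s <= m)%N -> (t <= m)%N -> arrow (p s) (p t) = (t == s.+1),
      forall l, off_path p m l -> arrow (p 0%N) l = false
    & forall l t, off_path p m l -> (t < m)%N ->
        arrow (p t.+1) l = arrow l (p t)].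

Definition path_sum n (p : nat -> hive n) j : lattice n :=
  \sum_(0 <= t < j.+1) initial_seed (p t).

Lemma path_sumS n (p : nat -> hive n) j :
  path_sum p j.+1 = path_sum p j + initial_seed (p j.+1).
Proof. by rewrite /path_sum big_nat_recr. Qed.

Section StraightPath.
Variables (n m : nat) (p : nat -> hive n).
Hypothesis pP : straight_path p m.

Let E j : lattice n := path_sum p j.
Let e t : lattice n := initial_seed (p t).

(** For [s < t] the arrow from [p s] to [p s.+1] would also leave [p t], which forces
    [s.+1 = t.+1]. *)
Lemma path_inj s t : (s <= m)%N -> (t <= m)%N -> p s = p t -> s = t.
Proof.
case: pP => _ pA _ _.
wlog st : s t / (s < t)%N.
  move=> H sm tm pst; case: (ltngtP s t) => // st; first exact: H.
  by apply/esym/H.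
move=> sm tm pst; have s1m : (s.+1 <= m)%N by exact: leq_trans st tm.
by have := pA s s.+1 sm s1m; rewrite pst pA // eqxx eqSS => /eqP.
Qed.

Lemma form_path s t : (s <= m)%N -> (t <= m)%N ->
  form (e s) (e t) = (t == s.+1)%:R - (s == t.+1)%:R.
Proof. by case: pP => _ pA _ _ sm tm; rewrite form_initial_seed !pA. Qed.

(** On the path, [e s] pairs to [-1] with [e s.-1], present as [s > 0], to [1] with [e s.+1], and to
    [0] otherwise; so the partial sums vanish except for [j = s.-1] and [j = s]. *)
Lemma form_path_sum s j : (0 < s <= m)%N -> (j <= m)%N ->
  form (e s) (E j) = - ((s == j) || (s == j.+1))%:R.
Proof.
move=> /andP[s0 sm]; elim: j => [|j IH] jm.
  rewrite /E /path_sum big_nat1 form_path // eq_sym.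
  by rewrite (gtn_eqF s0) /= add0r; case: s s0 {sm}.
rewrite /E path_sumS raddfD /= IH ?(ltnW jm) // form_path //.
by rewrite eqSS; lia.
Qed.

(** By the triangle clause the pairings with the [e t] are differences of consecutive values
    [arrow l (p t)], and the sum telescopes. This gives the nonnegativity in the initial seed. *)
Lemma form_off_path l j : off_path p m l -> (j <= m)%N ->
  form (initial_seed l) (E j) = (arrow l (p j))%:R.
Proof.
case: pP => _ _ p0 pt lP; elim: j => [|j IH] jm.
  by rewrite /E /path_sum big_nat1 form_initial_seed p0 // subr0.
rewrite /E path_sumS raddfD /= IH ?(ltnW jm) // form_initial_seed pt //.
by rewrite addrC subrK.
Qed.

(* The state of a seed after the mutations at [p 1, ..., p i]. *)
Definition mutated_upto i (s : seed n) : Prop :=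
  [/\ s (p 0%N) = E i,
      forall t, (0 < t <= i)%N -> s (p t) = - e t,
      forall t, (i < t <= m)%N -> s (p t) = e t
    & forall l j, off_path p m l -> (i <= j <= m)%N -> 0 <= form (s l) (E j)].

Lemma mutated_upto0 : mutated_upto 0 (@initial_seed n).
Proof.
split=> [|t|//|l j lP /andP[_ jm]]; last by rewrite form_off_path // ler0n.
  by rewrite /E /path_sum big_nat1.
by move=> /andP[]; case: t.
Qed.

Lemma mutated_uptoS i (s : seed n) (k : uf_index n) :
  (i < m)%N -> val k = p i.+1 -> mutated_upto i s ->
  mutated_upto i.+1 (mutate s k).
Proof.
move=> im kE [s0 sN sP sO].
have sk : s (p i.+1) = e i.+1 by apply: sP; rewrite ltnSn.
have neq t : (t <= m)%N -> t != i.+1 -> (p t == p i.+1) = false.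
  by move=> tm; apply: contra_neqF => /eqP; apply: path_inj.
(* Mutation fixes whatever pairs nonpositively with [e i.+1]: this covers all [p t] except [p 0] and
   [p i.+1]. *)
have fix_ x : form x (e i.+1) <= 0 ->
    x + e i.+1 *~ Num.max 0 (form x (e i.+1)) = x.
  by move=> /max_idPl ->; rewrite mulr0z addr0.
split=> [|t /andP[t0 ti]|t /andP[it tm]|l j lP /andP[ij jm]];
  rewrite /mutate kE sk.
- rewrite neq // s0 [form (E i) _]form_antisym form_path_sum ?(ltnW im) //.
  by rewrite eqxx orbT opprK /= mulr1z -path_sumS.
- case: (eqVneq t i.+1) => [->|ti1]; first by rewrite eqxx.
  have tm : (t <= m)%N by exact: leq_trans im.
  have lti : (t <= i)%N by rewrite -ltnS ltn_neqAle ti1.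
  rewrite neq // sN ?t0 // fix_ // formNl form_path //.
  by lia.
- rewrite neq ?gtn_eqF // sP ?tm ?(ltnW it) // fix_ // form_path //.
  by lia.
- have /negPf -> : l != p i.+1 by case: lP => _ ->.
  have sEi : 0 <= form (s l) (E i) by rewrite sO // leqnn ltnW.
  have sEj : 0 <= form (s l) (E j) by rewrite sO // jm ltnW.
  rewrite formDl formMzl form_path_sum //.
  (* For [j > i.+1] the added multiple of [e i.+1] is orthogonal to [E j]. For [j = i.+1] it lowers
     [{s l, E i} + {s l, e i.+1}] by the positive part of the second term, leaving the smaller of
     [{s l, E i}] and [{s l, E i.+1}]. *)
  have := sEj; case: (eqVneq i.+1 j) => [<-|ij'] /=; last first.
    by rewrite ltn_eqF ?ltnS // oppr0 mul0rz addr0.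
  rewrite /E path_sumS raddfD /= mulNrz -/(E i) -/(e i.+1) intz.
  by move: sEi; lia.
Qed.

(** Off the path this is the last clause of [mutated_upto] at [j = m]; on it the vectors have become
    [- e t], and [form_path_sum] gives [0] or [1]. *)
Lemma mutated_upto_optimized (w : seq (uf_index n)) :
  mutated_upto m (seed_at w) -> optimized w (p 0%N).
Proof.
move=> [s0 sN _ sO] k; rewrite s0.
have [/existsP[t /eqP kE]|/existsPn kP] :=
    boolP [exists t : 'I_m.+1, val k == p t]; last first.
  apply: sO; last by rewrite leqnn.
  split; first exact: valP k.
  by move=> t tm; apply: (kP (Ordinal (tm : (t < m.+1)%N))).
have tm : (t <= m)%N by rewrite -ltnS.
rewrite kE; case: (posnP t) => [->|t0].
  by rewrite s0 form_antisym le_eqVlt; have := form_antisym (E m) (E m); lia.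
by rewrite sN ?t0 // formNl form_path_sum ?t0 // opprK ler0n.
Qed.

Lemma theta_straight_path (R : realType)
    (g : seq (uf_index n) -> torus_ring R n) :
  is_theta (p 0%N) g ->
  g [::] = \sum_(0 <= j < m.+1) zexp R (- path_sum p j).
Proof.
case=> gD gO.
(* Induction runs back from the optimized seed: [d] counts the mutations still to come, and the
   torus of [w] carries the terms from [i] on. *)
suff H d i w : (i + d = m)%N -> mutated_upto i (seed_at w) ->
    g w = \sum_(i <= j < m.+1) zexp R (- E j).
  exact: (H m 0%N [::] (add0n m) mutated_upto0).
elim: d i w => [|d IH] i w.
  rewrite addn0 => -> mw; rewrite big_nat1 gO; last exact: mutated_upto_optimized.
  by case: mw => ->.
move=> idm mw; have im : (i < m)%N by lia.
case: pP => pU _ _ _.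
pose k : uf_index n := exist _ (p i.+1) (pU i im).
have kE : seed_at w (val k) = e i.+1 by case: mw => _ _ ->//; rewrite ltnSn.
apply/eqP; rewrite -tofrac_eq (gD w k).
rewrite (IH i.+1); [|lia|by rewrite seed_at_rcons; exact: mutated_uptoS].
have pull j : (i < j <= m)%N ->
    mutation_pullback (seed_at w (val k)) (zexp R (- E j)) =
    (zexp R (- E j))%:F * (1 + zexp R (e i.+1))%:F ^ (i.+1 == j)%:R.
  move=> /andP[ij jm]; rewrite mutation_pullback_zexp kE formNl opprK.
  rewrite form_antisym form_path_sum // opprK.
  by rewrite [(_ == j.+1)%N]ltn_eqF ?orbF // ltnS.
(* The right side has one term more: its terms [i] and [i.+1] both come from pulling back the term
   [i.+1]. *)
rewrite raddf_sum rmorph_sum /= [X in _ == X]big_ltn ?ltnS ?(ltnW im) //.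
rewrite big_ltn ?ltnS // [X in _ == _ + X]big_ltn ?ltnS //.
rewrite pull ?ltnSn // eqxx expr1z -tofracM mulrDr mulr1 zexpM.
rewrite addrA [X in _ == X + _]addrC -tofracD.
have -> : - E i.+1 + e i.+1 = - E i by rewrite /E path_sumS opprD addrNK.
apply/eqP; congr (_ + _).
apply: eq_big_nat => j /andP[ij jm]; rewrite pull ?(ltnW ij) //.
by rewrite ltn_eqF // expr0z mulr1.
Qed.

End StraightPath.

(** * Lines of the hive and their rotations *)

Lemma sum_coordsE n (h : hive n) (a b c : nat) :
  coords h = (a, b, c) -> (a + b + c)%N = n.
Proof. by case: h => [[[x y] z] /= hP] [<- <- <-]; apply/eqP. Qed.

Lemma coords_surj n (a b c : nat) : (a + b + c)%N = n ->
  {h : hive n | coords h = (a, b, c)}.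
Proof.
move=> abc; have [an bn cn] : [/\ a < n.+1, b < n.+1 & c < n.+1]%N by split; lia.
have hP : ((Ordinal an : nat) + (Ordinal bn : nat) + (Ordinal cn : nat) == n)%N.
  exact/eqP.
by exists (exist _ (Ordinal an, Ordinal bn, Ordinal cn) hP).
Qed.

Lemma arrowE n (g h : hive n) (a b c a' b' c' : nat) :
  coords g = (a, b, c) -> coords h = (a', b', c') ->
  arrow g h = ([&& 0 < a, 0 < b & 0 < c] || [&& 0 < a', 0 < b' & 0 < c'])%N &&
    [|| [&& a == a'.+1, b' == b.+1 & c' == c],
        [&& a' == a, b == b'.+1 & c' == c.+1]
      | [&& a' == a.+1, b' == b & c == c'.+1]]%N.
Proof. by rewrite /arrow /unfrozen => -> ->. Qed.

Lemma unfrozenE n (h : hive n) (a b c : nat) :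
  coords h = (a, b, c) -> unfrozen h = [&& 0 < a, 0 < b & 0 < c]%N.
Proof. by rewrite /unfrozen => ->. Qed.

(** From [p 0], with third entry [0], the only direction into the interior keeps the first entry
    [a]. The two arrow directions off the line, [(-1,1,0)] and [(1,0,-1)], add up to the step from
    [p t.+1] back to [p t], which closes the triangles. *)
Lemma straight_path_line n (p : nat -> hive n) (a m : nat) :
  (0 < a)%N ->
  (forall t, (t <= m)%N -> coords (p t) = (a, m.+1 - t, t)%N) ->
  straight_path p m.
Proof.
move=> a0 pE; have off l : off_path p m l ->
    exists x y z, [/\ coords l = (x, y, z), (x + y + z = n)%N, x != a
                    & [&& 0 < x, 0 < y & 0 < z]%N].
  case; rewrite /unfrozen; case lE: (coords l) => [[x y] z] l0 lp.
  exists x, y, z; split=> //; first exact: sum_coordsE lE.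
  (* An unfrozen vertex with first entry [a] and third entry [z] is [p z]; its positive second entry
     gives [z <= m]. *)
  apply/eqP => xa; have := sum_coordsE (pE 0%N isT); have := sum_coordsE lE.
  move=> ln pn; have zm : (z <= m)%N by lia.
  case/eqP: (lp z zm); apply: coords_inj; rewrite lE pE //; congr (_, _, _); lia.
split=> [t tm|s t sm tm|l /off|l t /off].
- by rewrite (unfrozenE (pE _ tm)); lia.
- by rewrite (arrowE (pE _ sm) (pE _ tm)); lia.
- by move=> [x [y [z [lE ln xa l0]]]]; rewrite (arrowE (pE 0%N isT) lE); lia.
- move=> [x [y [z [lE ln xa l0]]]] tm.
  have pn := sum_coordsE (pE 0%N isT).
  by rewrite (arrowE (pE _ tm) lE) (arrowE lE (pE _ (ltnW tm))); lia.
Qed.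

Lemma rot_hive_subproof n (h : hive n) :
  {g : hive n | coords g = ((coords h).2, (coords h).1.1, (coords h).1.2)}.
Proof.
apply: coords_surj; case hE: (coords h) => [[a b] c] /=.
by rewrite -(sum_coordsE hE); lia.
Qed.

(** Rotating in this direction sends lines of constant first entry to lines of constant second
    entry, and twice to constant third entry. *)
Definition rot_hive n (h : hive n) : hive n := sval (rot_hive_subproof h).

Lemma coords_rot_hive n (h : hive n) (a b c : nat) :
  coords h = (a, b, c) -> coords (rot_hive h) = (c, a, b).
Proof.
by move=> hE; rewrite /rot_hive; case: rot_hive_subproof => g; rewrite hE.
Qed.

Lemma rot_hive3 n (h : hive n) : rot_hive (rot_hive (rot_hive h)) = h.
Proof.
apply: coords_inj; case hE: (coords h) => [[a b] c].
by do 3![apply: coords_rot_hive].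
Qed.

Lemma unfrozen_rot_hive n (h : hive n) : unfrozen (rot_hive h) = unfrozen h.
Proof.
case hE: (coords h) => [[a b] c].
by rewrite (unfrozenE hE) (unfrozenE (coords_rot_hive hE)); lia.
Qed.

Lemma arrow_rot_hive n (g h : hive n) :
  arrow (rot_hive g) (rot_hive h) = arrow g h.
Proof.
case gE: (coords g) => [[a b] c]; case hE: (coords h) => [[a' b'] c'].
rewrite (arrowE gE hE) (arrowE (coords_rot_hive gE) (coords_rot_hive hE)).
by lia.
Qed.

Lemma straight_path_rot n (p : nat -> hive n) m :
  straight_path p m -> straight_path (@rot_hive n \o p) m.
Proof.
case=> pU pA p0 pt; have off l : off_path (@rot_hive n \o p) m l ->
    exists2 l', l = rot_hive l' & off_path p m l'.
  (* The rotation has order three, so applying it twice inverts it. *)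
  move=> [lU lp]; exists (rot_hive (rot_hive l)); first by rewrite rot_hive3.
  split=> [|t tm]; first by rewrite !unfrozen_rot_hive.
  by apply: contra_neq (lp t tm) => /= <-; rewrite rot_hive3.
split=> [t tm|s t sm tm|l /off[l' -> l'P]|l t /off[l' -> l'P] tm] /=.
- by rewrite unfrozen_rot_hive pU.
- by rewrite arrow_rot_hive pA.
- by rewrite arrow_rot_hive p0.
- by rewrite !arrow_rot_hive pt.
Qed.

Lemma hive_line n (a m : nat) : (a + m.+1 = n)%N ->
  {p : nat -> hive n |
    forall t, (t <= m)%N -> coords (p t) = (a, m.+1 - t, t)%N}.
Proof.
(* Truncating at [m] makes the path constant from there on, hence defined for every [t]. *)
move=> amn; have H t : (a + (m.+1 - minn t m) + minn t m = n)%N by lia.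
exists (fun t => sval (coords_surj (H t))) => t tm.
by case: coords_surj => h /= ->; rewrite (minn_idPl tm).
Qed.

Lemma theta_line (R : realType) n (p : nat -> hive n) m
    (f : hive n) (g : seq (uf_index n) -> torus_ring R n) (x : nat -> lattice n) :
  straight_path p m -> coords f = coords (p 0%N) -> is_theta f g ->
  (forall t, (t <= m)%N -> initial_seed (p t) = x t) ->
  g [::] = \sum_(0 <= i < m.+1) zexp R (- \sum_(0 <= j < i.+1) x j).
Proof.
move=> pP /coords_inj -> /(theta_straight_path pP) -> px.
apply: eq_big_nat => i /andP[_ im]; congr (zexp R (- _)).
by apply: eq_big_nat => j /andP[_ ji]; rewrite px // -ltnS (leq_trans ji).
Qed.

Lemma initial_seed_coords n (h : hive n) (a b c : nat) :
  coords h = (a, b, c) -> initial_seed h = evec n a b c.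
Proof. by rewrite /initial_seed => ->. Qed.

Theorem corollary20 (R : realType) (n : nat) (n_ge1 : (1 <= n)%N)
    (theta : hive n -> seq (uf_index n) -> torus_ring R n)
    (thetaP : forall f : hive n, boundary f -> is_theta f (theta f)) :
  [/\ LG_potential theta [::] =
        \sum_(f : hive n | let: (a, b, c) := coords f in
                           [&& 0 < a, 0 < b & c == 0]%N) theta f [::]
        + \sum_(f : hive n | let: (a, b, c) := coords f in
                             [&& a == 0, 0 < b & 0 < c]%N) theta f [::]
        + \sum_(f : hive n | let: (a, b, c) := coords f in
                             [&& 0 < a, b == 0 & 0 < c]%N) theta f [::],
      forall (f : hive n) (a b : nat), (0 < a)%N -> (0 < b)%N ->
        coords f = (a, b, 0%N) ->
        theta f [::] =
          \sum_(0 <= i < n - a)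
             zexp R (- \sum_(0 <= j < i.+1) evec n a (b - j) j),
      forall (f : hive n) (b c : nat), (0 < b)%N -> (0 < c)%N ->
        coords f = (0%N, b, c) ->
        theta f [::] =
          \sum_(0 <= i < n - b)
             zexp R (- \sum_(0 <= j < i.+1) evec n j b (c - j))
    & forall (f : hive n) (a c : nat), (0 < a)%N -> (0 < c)%N ->
        coords f = (a, 0%N, c) ->
        theta f [::] =
          \sum_(0 <= i < n - c)
             zexp R (- \sum_(0 <= j < i.+1) evec n (a - j) j c)].
Proof.
split.
(* Split by [c = 0], then by [a = 0]; since exactly one entry vanishes, the rest has [b = 0]. *)
- rewrite -addrA [LHS](bigID (fun f : hive n => (coords f).2 == 0%N)).
  congr (_ + _);
    last rewrite [LHS](bigID (fun f : hive n => (coords f).1.1 == 0%N)).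
    apply: eq_bigl => f; rewrite /boundary /coords.
    by move: (val f).1.1 (val f).1.2 (val f).2 => [[|a] ?] [[|b] ?] [[|c] ?].
  congr (_ + _); apply: eq_bigl => f; rewrite /boundary /coords;
    by move: (val f).1.1 (val f).1.2 (val f).2 => [[|a] ?] [[|b] ?] [[|c] ?].
(* With [b = m.+1] the line stops at [(a, 1, m)], just before the opposite frozen side, so it has
   [n - a = m.+1] vertices. *)
- move=> f a [//|m] a0 _ fE; have fn := sum_coordsE fE.
  have fB : boundary f by rewrite /boundary fE; case: (a) a0.
  have [p pE] := @hive_line n a m ltac:(lia).
  have -> : (n - a = m.+1)%N by lia.
  apply: (theta_line (straight_path_line a0 pE) _ (thetaP f fB)).
    by rewrite pE.
  by move=> t tm; exact/initial_seed_coords/pE.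
- move=> f b [//|m] b0 _ fE; have fn := sum_coordsE fE.
  have fB : boundary f by rewrite /boundary fE; case: (b) b0.
  have [p pE] := @hive_line n b m ltac:(lia).
  have -> : (n - b = m.+1)%N by lia.
  have pP := straight_path_rot (straight_path_line b0 pE).
  apply: (theta_line pP _ (thetaP f fB)).
    by rewrite fE (coords_rot_hive (pE 0%N isT)).
  by move=> t tm; exact/initial_seed_coords/coords_rot_hive/pE.
- move=> f [//|m] c _ c0 fE; have fn := sum_coordsE fE.
  have fB : boundary f by rewrite /boundary fE; case: (c) c0.
  have [p pE] := @hive_line n c m ltac:(lia).
  have -> : (n - c = m.+1)%N by lia.
  (* Two rotations turn [(c, m.+1 - t, t)] into [(m.+1 - t, t, c)]. *)
  have pP := straight_path_rot (straight_path_rot (straight_path_line c0 pE)).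
  apply: (theta_line pP _ (thetaP f fB)).
    by rewrite fE (coords_rot_hive (coords_rot_hive (pE 0%N isT))).
  by move=> t tm; exact/initial_seed_coords/coords_rot_hive/coords_rot_hive/pE.
Qed.
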